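(* Let $(M,g)$ be a pseudo-Riemannian manifold with Levi-Civita connection $\nabla^g$, whose Ricci tensor $\mathrm{Ric}$ is non-degenerate (hence a pseudo-Riemannian metric). Let $f,\lambda$ be smooth functions on $M$ such that $(g,f,\lambda)$ defines a gradient almost Ricci soliton, i.e. $\mathrm{Hess}(f)+\mathrm{Ric}=\lambda g$. Then $(\mathrm{Ric},\nabla^g)$ is a statistical structure on $M$ if and only if $$g(R^{\nabla^g}(X,Y)\nabla f,Z)=X(\lambda)g(Y,Z)-Y(\lambda)g(X,Z)$$ for all $X,Y,Z\in\mathfrak{X}(M)$.
   Context: A statistical structure on a smooth manifold $M$ is a pair $(h,\nabla)$ where $h$ is a pseudo-Riemannian metric, $\nabla$ is a torsion-free affine connection, and $(\nabla_X h)(Y,Z)=(\nabla_Y h)(X,Z)$ for all $X,Y,Z\in\mathfrak{X}(M)$. $\nabla f$ is the $g$-gradient of $f$, $\mathrm{Hess}(f)(X,Y)=g(\nabla^g_X\nabla f,Y)$, and $R^{\nabla^g}(X,Y)=\nabla^g_X\nabla^g_Y-\nabla^g_Y\nabla^g_X-\nabla^g_{[X,Y]}$. *)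

(* Defs.v *)
From HB Require Import structures.
From mathcomp Require Import all_boot all_order all_algebra.
From mathcomp Require Import all_classical all_reals all_analysis ring.
Import GRing.Theory numFieldNormedType.Exports.

Set Implicit Arguments.
Unset Strict Implicit.
Unset Printing Implicit Defensive.

Local Open Scope classical_set_scope.
Local Open Scope ring_scope.

(** * Smooth functions on open subsets of R^n *)

Section SmoothOn.
Variables (R : realType) (n : nat).
Implicit Types (U : set 'rV[R]_n) (f g : 'rV[R]_n -> R).

Definition evec (i : 'I_n) : 'rV[R]_n := delta_mx 0 i.

(* [U] is meant to be open. *)
Fixpoint Ck_on (k : nat) U f : Prop :=
  (forall x, U x -> {for x, continuous f}) /\
  if k is k'.+1 then
    forall i : 'I_n, (forall x, U x -> derivable f x (evec i)) /\
                     Ck_on k' U (fun x => 'D_(evec i) f x)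
  else True.

Definition smooth_on U f : Prop := forall k, Ck_on k U f.

Lemma Ck_on_weaken k U f : Ck_on k.+1 U f -> Ck_on k U f.
Proof.
elim: k f => [|k IH] f [cf df]; split=> // i.
by have [dfi Df] := df i; split=> //; exact: IH.
Qed.

Lemma Ck_on_eq k U f g : open U -> (forall x, U x -> f x = g x) ->
  Ck_on k U f -> Ck_on k U g.
Proof.
move=> oU.
have nearU (h1 h2 : _ -> R) x : (forall x, U x -> h1 x = h2 x) -> U x ->
    \forall y \near x, h1 y = h2 y.
  by move=> h12 Ux; apply: filterS (open_nbhs_nbhs (conj oU Ux)).
have ctsU (h1 h2 : _ -> R) x : (forall x, U x -> h1 x = h2 x) -> U x ->
    {for x, continuous h1} -> {for x, continuous h2}.
  move=> h12 Ux; rewrite /prop_for /continuous_at -(h12 x Ux).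
  move=> ch; apply: cvg_trans ch; apply: (@near_eq_cvg _ _ (nbhs x)).
  by apply: nearU => // y Uy; rewrite h12.
elim: k f g => [|k IH] f g fg [cf df]; split=> //.
- by move=> x Ux; apply: ctsU (cf x Ux).
- by move=> x Ux; apply: ctsU (cf x Ux).
- move=> i; have [dfi Df] := df i; split=> [x Ux|].
    by apply: near_eq_derivable (dfi x Ux); exact: nearU.
  by apply: IH Df => x Ux; apply: near_eq_derive; exact: nearU.
Qed.

Lemma Ck_on_cst k U (a : R) : open U -> Ck_on k U (cst a).
Proof.
move=> oU; elim: k a => [|k IH] a; (split; first by move=> x _; exact: cst_continuous).
  by [].
move=> i; split=> [x _|]; first exact: derivable_cst.
by apply: Ck_on_eq (IH 0) => // x _; rewrite derive_cst.
Qed.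

Lemma Ck_onD k U f g : open U -> Ck_on k U f -> Ck_on k U g ->
  Ck_on k U (fun x => f x + g x).
Proof.
move=> oU; elim: k f g => [|k IH] f g [cf df] [cg dg].
  by split=> // x Ux; exact: (continuousD (cf x Ux) (cg x Ux)).
split=> [x Ux|i]; first exact: (continuousD (cf x Ux) (cg x Ux)).
have [dfi Df] := df i; have [dgi Dg] := dg i.
split=> [x Ux|]; first by apply: derivableD; [exact: dfi|exact: dgi].
apply: Ck_on_eq (IH _ _ Df Dg) => // x Ux.
by rewrite -[RHS]/('D__ (f + g) x) deriveD //; [exact: dfi|exact: dgi].
Qed.

Lemma Ck_onM k U f g : open U -> Ck_on k U f -> Ck_on k U g ->
  Ck_on k U (fun x => f x * g x).
Proof.
move=> oU; elim: k f g => [|k IH] f g Cf Cg; have [cf df] := Cf;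
  have [cg dg] := Cg.
  by split=> // x Ux; exact: (continuousM (cf x Ux) (cg x Ux)).
split=> [x Ux|i]; first exact: (continuousM (cf x Ux) (cg x Ux)).
have [dfi Df] := df i; have [dgi Dg] := dg i.
split=> [x Ux|]; first by apply: derivableM; [exact: dfi|exact: dgi].
have C1 := IH _ _ (Ck_on_weaken Cf) Dg.
have C2 := IH _ _ (Ck_on_weaken Cg) Df.
apply: Ck_on_eq (Ck_onD oU C1 C2) => // x Ux.
by rewrite -[RHS]/('D__ (f * g) x) deriveM //; [exact: dfi|exact: dgi].
Qed.

End SmoothOn.

(** * Smooth manifolds *)

Record chart (R : realType) (n : nat) (T : topologicalType) := Chart {
  dom : set T;
  chart_fun :> T -> 'rV[R]_n;
  chart_inv : 'rV[R]_n -> T;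
  dom_open : open dom;
  im_open : open (chart_fun @` dom);
  chart_funK : {in dom, cancel chart_fun chart_inv};
  chart_fun_cts : forall p, dom p -> {for p, continuous chart_fun};
  chart_inv_cts :
    forall x, (chart_fun @` dom) x -> {for x, continuous chart_inv}
}.

(* smoothness of c' o c^-1 : c(dom c n dom c') -> R^n, coordinate by
   coordinate *)
Definition smooth_transition (R : realType) (n : nat) (T : topologicalType)
    (c c' : chart R n T) : Prop :=
  forall j : 'I_n,
    smooth_on (c @` (dom c `&` dom c')) (fun x => c' (chart_inv c x) 0 j).

Record manifold (R : realType) (n : nat) := Manifold {
  points :> topologicalType;
  atlas : set (chart R n points);
  manifold_hausdorff : hausdorff_space points;
  manifold_second_countable : @second_countable points;
  atlas_cover : forall p, exists2 c, atlas c & dom c p;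
  atlas_compat : forall c c', atlas c -> atlas c' -> smooth_transition c c'
}.

(** * The algebra of smooth functions *)

Section SmoothFunctions.
Variables (R : realType) (n : nat) (M : manifold R n).

Definition smooth (f : M -> R) : Prop :=
  forall c, atlas c -> smooth_on (c @` dom c) (fun x => f (chart_inv c x)).

Definition smoothp : {pred M -> R} := [pred f | `[< smooth f >]].

Lemma smoothpP f : reflect (smooth f) (f \in smoothp).
Proof. exact: asboolP. Qed.

Lemma smooth_cst (a : R) : smooth (cst a).
Proof. by move=> c _ k; apply: Ck_on_cst; exact: im_open. Qed.

Lemma smoothD (f g : M -> R) : smooth f -> smooth g -> smooth (f + g).
Proof.
move=> sf sg c ac k; apply: Ck_onD; [exact: im_open|exact: sf|exact: sg].
Qed.

Lemma smoothM (f g : M -> R) : smooth f -> smooth g -> smooth (f * g).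
Proof.
move=> sf sg c ac k; apply: Ck_onM; [exact: im_open|exact: sf|exact: sg].
Qed.

Lemma smoothp_submod_closed : submod_closed smoothp.
Proof.
split=> [|a f g /smoothpP sf /smoothpP sg]; apply/smoothpP.
  exact: (smooth_cst 0).
by apply: smoothD => //; exact: (smoothM (smooth_cst a) sf).
Qed.

Lemma smoothp_subring_closed : subring_closed smoothp.
Proof.
split=> [|f g /smoothpP sf /smoothpP sg|f g /smoothpP sf /smoothpP sg];
  apply/smoothpP.
- exact: (smooth_cst 1).
- have := smoothD sf (smoothM (smooth_cst (-1)) sg).
  suff -> : cst (-1) * g = - g :> (M -> R) by [].
  by apply/funext => p /=; exact: mulN1r.
- exact: smoothM.
Qed.

HB.instance Definition _ :=
  GRing.isSubmodClosed.Build R _ smoothp smoothp_submod_closed.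

Record smooth_fun := SmoothFun {
  smooth_val :> M -> R;
  _ : smooth_val \in smoothp
}.

HB.instance Definition _ := [isSub for smooth_val].
HB.instance Definition _ := [Choice of smooth_fun by <:].
HB.instance Definition _ := 
  GRing.SubChoice_isSubComPzRing.Build _ _ smooth_fun smoothp_subring_closed.
HB.instance Definition _ := [SubZmodule_isSubLmodule of smooth_fun by <:].

End SmoothFunctions.

Notation "''C^∞' ( M )" := (smooth_fun M) (at level 8, format "''C^∞' ( M )").

(** * Tangent spaces and vector fields *)

Section Tangent.
Variables (R : realType) (n : nat) (M : manifold R n).

Definition is_tangent (p : M) (v : 'C^∞(M) -> R) : Prop :=
  scalar v /\ forall f g, v (f * g) = f p * v g + g p * v f.

Definition tangentp (p : M) : {pred 'C^∞(M) -> R^o} :=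
  [pred v | `[< is_tangent p v >]].

Lemma tangentp_submod_closed (p : M) : submod_closed (tangentp p).
Proof.
split=> [|a u v /asboolP [lu Lu] /asboolP [lv Lv]]; apply/asboolP; split.
- by move=> k f g; change (0 = k * 0 + 0 :> R); ring.
- by move=> f g; change (0 = f p * 0 + g p * 0 :> R); ring.
- move=> k f g; change (a * u (k *: f + g) + v (k *: f + g) =
    k * (a * u f + v f) + (a * u g + v g)).
  by rewrite lu lv /=; ring.
- move=> f g; change (a * u (f * g) + v (f * g) =
    f p * (a * u g + v g) + g p * (a * u f + v f)).
  by rewrite Lu Lv; ring.
Qed.

HB.instance Definition _ (p : M) :=
  GRing.isSubmodClosed.Build R _ (tangentp p) (tangentp_submod_closed p).

Record tangent (p : M) := Tangent {
  tangent_val :> 'C^∞(M) -> R^o;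
  _ : tangent_val \in tangentp p
}.

HB.instance Definition _ (p : M) := [isSub for @tangent_val p].
HB.instance Definition _ (p : M) := [Choice of tangent p by <:].
HB.instance Definition _ (p : M) := [SubChoice_isSubZmodule of tangent p by <:].
HB.instance Definition _ (p : M) := [SubZmodule_isSubLmodule of tangent p by <:].

(* A derivation X of C^∞(M) is the same thing as a family of tangent vectors
   X_p (see [vf_at]) such that p |-> X_p f is smooth for all smooth f. *)
Definition is_derivation (X : 'C^∞(M) -> 'C^∞(M)) : Prop :=
  (forall (k : R) f g, X (k *: f + g) = k *: X f + X g) /\
  forall f g, X (f * g) = f * X g + g * X f.

Definition derivationp : {pred 'C^∞(M) -> 'C^∞(M)^o} :=
  [pred X | `[< is_derivation X >]].

Lemma smooth_scalerAr (k : R) (f g : 'C^∞(M)) : f * (k *: g) = k *: (f * g).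
Proof.
by apply/val_inj/funext => p /=; rewrite /GRing.scale /= /GRing.mul /=;
  exact: mulrCA.
Qed.

Lemma derivationp_submod_closed : submod_closed derivationp.
Proof.
split=> [|a X Y /asboolP [lX LX] /asboolP [lY LY]]; apply/asboolP; split.
- by move=> k f g; change (0 = k *: 0 + 0 :> 'C^∞(M)); rewrite scaler0 addr0.
- by move=> f g; change (0 = f * 0 + g * 0 :> 'C^∞(M)); ring.
- move=> k f g; change (a * X (k *: f + g) + Y (k *: f + g) =
    k *: (a * X f + Y f) + (a * X g + Y g)).
  by rewrite lX lY mulrDr smooth_scalerAr scalerDr addrACA.
- move=> f g; change (a * X (f * g) + Y (f * g) =
    f * (a * X g + Y g) + g * (a * X f + Y f)).
  by rewrite LX LY; ring.
Qed.

HB.instance Definition _ :=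
  GRing.isSubmodClosed.Build _ _ derivationp derivationp_submod_closed.

Record vector_field := VectorField {
  vf_val :> 'C^∞(M) -> 'C^∞(M)^o;
  _ : vf_val \in derivationp
}.

HB.instance Definition _ := [isSub for vf_val].
HB.instance Definition _ := [Choice of vector_field by <:].
HB.instance Definition _ := [SubChoice_isSubZmodule of vector_field by <:].
HB.instance Definition _ := [SubZmodule_isSubLmodule of vector_field by <:].

Lemma vector_fieldP (X : vector_field) : is_derivation X.
Proof. exact/asboolP/(valP X). Qed.

Lemma vf_at_proof (X : vector_field) (p : M) :
  (fun f => X f p : R^o) \in tangentp p.
Proof.
have [lX LX] := vector_fieldP X.
by apply/asboolP; split=> [k f g|f g]; rewrite (lX, LX).
Qed.

Definition vf_at (X : vector_field) (p : M) : tangent p :=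
  Tangent (vf_at_proof X p).

Lemma bracket_proof (X Y : vector_field) :
  (fun f => X (Y f) - Y (X f)) \in derivationp.
Proof.
have [lX LX] := vector_fieldP X; have [lY LY] := vector_fieldP Y.
have XD f g : X (f + g) = X f + X g by have := lX 1 f g; rewrite !scale1r.
have YD f g : Y (f + g) = Y f + Y g by have := lY 1 f g; rewrite !scale1r.
apply/asboolP; split=> [k f g|f g].
  by rewrite lX lY lX lY scalerBr opprD addrACA.
rewrite LX LY XD YD !LX !LY !mulrBr !opprD.
ring.
Qed.

Definition bracket (X Y : vector_field) : vector_field :=
  VectorField (bracket_proof X Y).

End Tangent.

(** * Metrics, connections, curvature *)

Section Geometry.
Variables (R : realType) (n : nat) (M : manifold R n).

Local Notation VF := (vector_field M).
Local Notation F := 'C^∞(M).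

Implicit Types (h : VF -> VF -> F) (D : VF -> VF -> VF) (X Y Z : VF).

Definition is_tensor2 h : Prop :=
  (forall Y, scalar (fun X => h X Y)) /\ (forall X, scalar (h X)).

Definition is_symmetric h : Prop := forall X Y, h X Y = h Y X.

(* nondegeneracy of the bilinear form induced by [h] on each T_pM *)
Definition nondegenerate_tensor h : Prop :=
  forall (p : M) X, (forall Y, h X Y p = 0) -> vf_at X p = 0.

(* The index is locally constant, and is not required to agree on different
   connected components. *)
Definition pseudo_riemannian_metric h : Prop :=
  [/\ is_tensor2 h, is_symmetric h & nondegenerate_tensor h].

(* C^∞(M)-linear in the direction, R-linear (by additivity and the Leibniz
   rule) in the argument *)
Definition affine_connection D : Prop :=
  [/\ forall Y, linear (fun X => D X Y),
      forall X Y Z, D X (Y + Z) = D X Y + D X Z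
    & forall X (f : F) Y, D X (f *: Y) = (X f : F) *: Y + f *: D X Y].

Definition torsion_free D : Prop :=
  forall X Y, D X Y - D Y X = bracket X Y.

(* (D_X h)(Y, Z) *)
Definition cov_deriv D h X Y Z : F :=
  X (h Y Z) - h (D X Y) Z - h Y (D X Z).

Definition levi_civita h D : Prop :=
  [/\ affine_connection D, torsion_free D
    & forall X Y Z, cov_deriv D h X Y Z = 0].

Definition statistical_structure h D : Prop :=
  [/\ pseudo_riemannian_metric h, affine_connection D, torsion_free D
    & forall X Y Z, cov_deriv D h X Y Z = cov_deriv D h Y X Z].

Definition curvature D X Y Z : VF :=
  D X (D Y Z) - D Y (D X Z) - D (bracket X Y) Z.

Definition is_basis_at (p : M) (e : 'I_n -> tangent p) : Prop :=
  forall v : tangent p, exists! c : 'rV[R]_n, v = \sum_i c 0 i *: e i.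

(* [t] is the trace of the endomorphism of T_pM induced by the C^∞(M)-linear
   map [A]: the matrix [a] represents it in a basis of T_pM made of values at
   [p] of vector fields. *)
Definition is_trace_at (A : VF -> VF) (p : M) (t : R) : Prop :=
  exists (E : 'I_n -> VF) (a : 'M[R]_n),
    [/\ is_basis_at (fun i => vf_at (E i) p),
        forall j, vf_at (A (E j)) p = \sum_i a i j *: vf_at (E i) p
      & t = \tr a].

(* Ric(Y, Z) = tr (X |-> R(X, Y) Z) *)
Definition is_ricci_tensor D (Ric : VF -> VF -> F) : Prop :=
  forall Y Z (p : M), is_trace_at (fun X => curvature D X Y Z) p (Ric Y Z p).

Definition is_gradient h (f : F) (G : VF) : Prop := forall X, h G X = X f.

(* Hess(f)(X, Y) = h(D_X grad f, Y), with [G] = grad f *)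
Definition hessian h D (G : VF) X Y : F := h (D X G) Y.

Definition gradient_almost_ricci_soliton h D (Ric : VF -> VF -> F)
    (G : VF) (lam : F) : Prop :=
  forall X Y, hessian h D G X Y + Ric X Y = lam * h X Y.

End Geometry.

(* Main.v *)
Require Import Defs.
From HB Require Import structures.
From mathcomp Require Import all_boot all_order all_algebra.
From mathcomp Require Import all_classical all_reals all_analysis.
From mathcomp Require Import ring.
Import GRing.Theory.
Local Open Scope ring_scope.

(** Substituting Ric = lam g - Hess f, and using that g is parallel,
    (D_X Ric)(Y, Z) = X(lam) g(Y, Z) - g(D_X D_Y grad f - D_(D_X Y) grad f, Z).
    Antisymmetrizing in X and Y, torsion-freeness turns the second covariant
    derivatives into the curvature, so the Codazzi equation for Ric is the
    asserted identity. The remaining requirements are automatic: Ric is a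
    tensor, symmetric because Hess f is. *)

Section VectorFields.
Context {R : realType} {n : nat} {M : manifold R n}.
Implicit Types (X Y Z : vector_field M) (a b : 'C^∞(M)).

Lemma vfD X a b : X (a + b) = X a + X b :> 'C^∞(M).
Proof. by have := (vector_fieldP X).1 1 a b; rewrite !scale1r. Qed.

Lemma vfB X a b : X (a - b) = X a - X b :> 'C^∞(M).
Proof. by apply: (addIr (X b)); rewrite -vfD !subrK. Qed.

Lemma vfM X a b : X (a * b) = a * X b + b * X a :> 'C^∞(M).
Proof. exact: (vector_fieldP X).2. Qed.

End VectorFields.

Section TensorLinearity.
Context {R : realType} {n : nat} {M : manifold R n}.
Context {h : vector_field M -> vector_field M -> 'C^∞(M)}.
Hypothesis h_tensor : is_tensor2 h.
Implicit Types X Y Z : vector_field M.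

Lemma tensor2Bl X Y Z : h (X - Y) Z = h X Z - h Y Z.
Proof.
(* Linearity is stated for [k *: u + v], so [X - Y] is first put in the form [-1 *: Y + X]. *)
by rewrite -scaleN1r addrC [LHS](h_tensor.1 Z) /= mulN1r addrC.
Qed.

End TensorLinearity.

Section Connection.
Context {R : realType} {n : nat} {M : manifold R n}.
Context {D : vector_field M -> vector_field M -> vector_field M}.
Implicit Types X Y Z : vector_field M.

Lemma connectionBl X Y Z : affine_connection D -> D (X - Y) Z = D X Z - D Y Z.
Proof.
by case=> Dl _ _; rewrite -scaleN1r addrC [LHS](Dl Z) scaleN1r addrC.
Qed.

End Connection.

Section Hessian.
Context {R : realType} {n : nat} {M : manifold R n}.
Context {g : vector_field M -> vector_field M -> 'C^∞(M)}.
Context {D : vector_field M -> vector_field M -> vector_field M}.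
Hypothesis g_metric : pseudo_riemannian_metric g.
Hypothesis D_LC : levi_civita g D.
Implicit Types X Y Z G : vector_field M.

Lemma metric_compat X Y Z : X (g Y Z) = g (D X Y) Z + g Y (D X Z) :> 'C^∞(M).
Proof.
have [_ _ /(_ X Y Z)] := D_LC.
by rewrite /cov_deriv -addrA -opprD => /eqP; rewrite subr_eq0 => /eqP.
Qed.

Lemma hessian_tensor G : is_tensor2 (hessian g D G).
Proof.
have [[gl gr] _ _] := g_metric; have [[Dl _ _] _ _] := D_LC.
by split=> [Y a X X'|X]; rewrite /hessian ?Dl //; exact: gl.
Qed.

(** This is the product rule for the parallel metric applied to [g G Y = Y f]. *)
Lemma hessian_gradient f G X Y : is_gradient g f G ->
  hessian g D G X Y = X (Y f) - D X Y f :> 'C^∞(M).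
Proof.
by move=> Gf; rewrite /hessian -!Gf metric_compat addrK.
Qed.

(** The antisymmetric part is [bracket X Y f - (D X Y - D Y X) f], which torsion-freeness kills. *)
Lemma hessian_symmetric f G : is_gradient g f G ->
  is_symmetric (hessian g D G).
Proof.
move=> Gf X Y; rewrite !(hessian_gradient f) //.
have [_ /(_ X Y) DXY _] := D_LC.
have : (D X Y - D Y X) f = bracket X Y f by rewrite DXY.
(* Differences and brackets of vector fields act on [f] by their defining formulas, up to
   conversion. *)
change (D X Y f - D Y X f = X (Y f) - Y (X f) :> 'C^∞(M) ->
  X (Y f) - D X Y f = Y (X f) - D Y X f :> 'C^∞(M)).
move=> E; have -> : X (Y f) = (D X Y f - D Y X f) + Y (X f) :> 'C^∞(M).
  by rewrite E subrK.
by rewrite addrC !addrA addNr add0r addrC.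
Qed.

(** Differentiating [g (D Y G) Z] yields a term [g (D Y G) (D X Z)] that cancels the correction in
    the slot of [Z]. *)
Lemma cov_deriv_hessian G X Y Z :
  cov_deriv D (hessian g D G) X Y Z = g (D X (D Y G)) Z - g (D (D X Y) G) Z.
Proof.
by rewrite /cov_deriv /hessian metric_compat addrAC addrK.
Qed.

(* Ricci identity *)
Lemma curvature_hessian G X Y Z :
  g (curvature D X Y G) Z =
  cov_deriv D (hessian g D G) X Y Z - cov_deriv D (hessian g D G) Y X Z.
Proof.
have [gt _ _] := g_metric; have [D_conn D_tf _] := D_LC.
(* With the bracket written as [D X Y - D Y X], its term splits into the two corrections of the
   second derivatives. *)
rewrite !cov_deriv_hessian /curvature -D_tf (connectionBl _ _ _ D_conn).
rewrite !(tensor2Bl gt); ring.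
Qed.

End Hessian.

Theorem proposition2p5 (R : realType) (n : nat) (M : manifold R n)
    (g : vector_field M -> vector_field M -> 'C^∞(M))
    (nabla : vector_field M -> vector_field M -> vector_field M)
    (Ric : vector_field M -> vector_field M -> 'C^∞(M))
    (f lam : 'C^∞(M)) (gradf : vector_field M)
    (g_metric : pseudo_riemannian_metric g)
    (nabla_LC : levi_civita g nabla)
    (Ric_ricci : is_ricci_tensor nabla Ric)
    (Ric_nondegenerate : nondegenerate_tensor Ric)
    (gradf_gradient : is_gradient g f gradf)
    (soliton : gradient_almost_ricci_soliton g nabla Ric gradf lam) :
  statistical_structure Ric nabla <->
  (forall X Y Z : vector_field M,
     g (curvature nabla X Y gradf) Z = X lam * g Y Z - Y lam * g X Z).
Proof.
have [[gl gr] g_sym _] := g_metric; have [nabla_conn nabla_tf _] := nabla_LC.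
pose H := hessian g nabla gradf.
have RicE X Y : Ric X Y = lam * g X Y - H X Y.
  by rewrite -soliton addrC addKr.
have cov_Ric X Y Z :
    cov_deriv nabla Ric X Y Z = X lam * g Y Z - cov_deriv nabla H X Y Z.
  (* The Leibniz rule splits off [X lam * g Y Z]; the rest of the [lam * g] part is [lam] times the
     vanishing derivative of [g]. *)
  rewrite /cov_deriv !RicE vfB vfM (metric_compat nabla_LC); ring.
(* The Codazzi defect of [Ric] equals the defect of the curvature identity, which gives both
   implications. *)
have codazziE X Y Z :
    cov_deriv nabla Ric X Y Z - cov_deriv nabla Ric Y X Z =
    X lam * g Y Z - Y lam * g X Z - g (curvature nabla X Y gradf) Z.
  rewrite !cov_Ric (curvature_hessian g_metric nabla_LC) -/H; ring.
split=> [[_ _ _ codazzi] X Y Z|curvE].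
  by apply/esym/subr0_eq; rewrite -codazziE codazzi subrr.
split=> // [|X Y Z]; last by apply/subr0_eq; rewrite codazziE curvE subrr.
(* Nondegeneracy is assumed; tensoriality and symmetry pass to [Ric] from [g] and [H] through
   [RicE]. *)
have [Hl Hr] : is_tensor2 H := hessian_tensor g_metric nabla_LC gradf.
split=> //; first split=> [Y a X X'|X a Y Y'].
- by rewrite !RicE [H _ _]Hl gl /=; ring.
- by rewrite !RicE [H _ _]Hr gr /=; ring.
- move=> X Y; rewrite !RicE g_sym; congr (_ - _).
  exact: (hessian_symmetric nabla_LC f).
Qed.
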